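(* Let the attacked linear system $\mathbf{x}(t+1)=A\mathbf{x}(t)+\mathbf{v}(t)$, $\mathbf{y}(t)=C\mathbf{x}(t)+\mathbf{e}(t)+\mathbf{w}(t)$ (with the notation of the context) be $2\bar{s}$-sparse observable and let $\epsilon=\epsilon^*$. Assume also that the number of attacked sensors is less than $\bar{s}$ and that for each attacked sensor $i$ the attack signal satisfies $$\|\mathbf{e}_i\| > \frac{2}{\sqrt{1-\Delta_s}}\,\overline{w} + \frac{\sqrt{\epsilon}}{\sqrt{1-\Delta_s}}.$$ Then the graph-search algorithm described in the context is complete; that is, if there exists a pair $(\mathbf{x},\mathbf{b})\in\mathbb{R}^n\times\{0,1\}^p$ satisfying, with $\mathcal{I}=\{1,\ldots,p\}\setminus\mathrm{supp}(\mathbf{b})$, $$\|\mathbf{Y}_{\mathcal{I}}-\mathcal{O}_{\mathcal{I}}\mathbf{x}\|_2\le\overline{w}_{\mathcal{I}}+\sqrt{\epsilon}\qquad\text{and}\qquad|\mathrm{supp}(\mathbf{b})|\le\bar{s},$$ then the algorithm finds such a pair (it terminates after finitely many iterations and returns a pair satisfying these two constraints).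
   Context: System. $A\in\mathbb{R}^{n\times n}$, $C\in\mathbb{R}^{p\times n}$; $\mathbf{x}(t)\in\mathbb{R}^n$ is the state and $\mathbf{y}(t)\in\mathbb{R}^p$ the measurements of $p$ sensors (known control inputs are subtracted, so the input matrix is taken to be zero); $\mathbf{v}(t),\mathbf{w}(t)$ are process and measurement noise; $\mathbf{e}(t)\in\mathbb{R}^p$ is the attack vector, whose $i$-th entry can be non-zero only if sensor $i$ is under attack. The set of attacked sensors does not change over time. Window. Fix a time $t$ and window length $T\in\{1,\ldots,n\}$, and write $\mathbf{x}_0=\mathbf{x}(t-T+1)$ for the true state. Stacking $\mathbf{y}(t-T+1),\ldots,\mathbf{y}(t)$ gives $\mathbf{Y}=\mathcal{O}\mathbf{x}_0+\mathbf{e}+\mathbf{w}$, where $\mathcal{O}=[C^\intercal,A^\intercal C^\intercal,\ldots,(A^\intercal)^{T-1}C^\intercal]^\intercal$, $\mathbf{e}$ stacks $\mathbf{e}(t-T+1),\ldots,\mathbf{e}(t)$, and the $k$-th block ($k=1,\ldots,T$) of $\mathbf{w}$ is $C\sum_{i=1}^{k-1}A^{k-1-i}\mathbf{v}(t-T+i)+\mathbf{w}(t-T+k)$. For $\mathcal{I}\subseteq\{1,\ldots,p\}$, $\mathbf{Y}_{\mathcal{I}},\mathcal{O}_{\mathcal{I}},\mathbf{e}_{\mathcal{I}},\mathbf{w}_{\mathcal{I}}$ denote the restrictions to the rows belonging to sensors in $\mathcal{I}$; for $\mathcal{I}=\{i\}$ write $\mathbf{Y}_i,\mathcal{O}_i,\mathbf{e}_i,\mathbf{w}_i$.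 $\|\cdot\|$ is the Euclidean norm; $\mathrm{supp}$ is the set of indices of non-zero entries. Bounds and constants. $\|\mathbf{w}_i\|\le\overline{w}_i$ for all $i$; $\overline{w}_{\mathcal{I}}=(\sum_{i\in\mathcal{I}}\overline{w}_i^2)^{1/2}$, $\overline{w}=(\sum_{i=1}^p\overline{w}_i^2)^{1/2}$. The integer $\bar{s}\le\lceil p/2\rceil-1$ is the known maximum allowable number of attacked sensors. $2\bar{s}$-sparse observable: the system remains observable after any $2\bar{s}$ sensors are removed, i.e. $\mathcal{O}_{\mathcal{I}}$ has full column rank $n$ whenever $|\mathcal{I}|\ge p-2\bar{s}$. $$\Delta_s=\max_{\substack{\Gamma\subset\mathcal{I}\subset\{1,\ldots,p\}\\ |\Gamma|\le\bar{s},\ |\mathcal{I}|\ge p-\bar{s}}}\lambda_{\max}\Big\{\big(\textstyle\sum_{i\in\Gamma}\mathcal{O}_i^{\intercal}\mathcal{O}_i\big)\big(\sum_{i\in\mathcal{I}}\mathcal{O}_i^{\intercal}\mathcal{O}_i\big)^{-1}\Big\},$$ with $\lambda_{\max}$ the maximal eigenvalue. $\epsilon^*$: for a reachable state $\mathbf{x}'$ put $\mathbf{Y}'=\mathcal{O}\mathbf{x}'$ and let $\tilde{\mathbf{x}}$ solve $\min_{\mathbf{x}}\|\mathbf{Y}'-\mathcal{O}\mathbf{x}\|$; then $\epsilon^*=\inf\{\epsilon:\|\mathbf{Y}'-\mathcal{O}\tilde{\mathbf{x}}\|\le\sqrt{\epsilon}\ \text{for all }\mathbf{x}'\}$. The number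 $\epsilon\ge 0$ is the solution accuracy. Graph-search algorithm. Input: $\mathbf{Y},\mathcal{O},p,(\overline{w}_i),\epsilon,\bar{s}$. A node is a tuple (level, value, parent, $\mathcal{I}$, residual), with level $l\in\{0,\ldots,p\}$, value in $\{0,1\}$ (value $1$: sensor $l$ is declared attacked; $0$: attack-free), $\mathcal{I}$ the set of levels in $\{1,\ldots,l\}$ assigned value $0$ on the path from the root to the node, and residual in $\{0,1\}$. Two nodes are equivalent if they have the same level and value. Node $v$ has higher priority than $v'$ if $v.\mathrm{level}-|v.\mathcal{I}|<v'.\mathrm{level}-|v'.\mathcal{I}|$, or if these are equal and $v.\mathrm{level}>v'.\mathrm{level}$ (remaining ties are resolved arbitrarily). Child generation: for a parent node and $id\in\{0,1\}$, the child has level one higher than its parent, value $id$, and that parent. If $id=0$, then child.$\mathcal{I}$ = parent.$\mathcal{I}\cup\{\text{child.level}\}$, and child.residual is $0$ if $\min_{\mathbf{x}\in\mathbb{R}^n}\|\mathbf{Y}_{\mathcal{I}}-\mathcal{O}_{\mathcal{I}}\mathbf{x}\|\le\overline{w}_{\mathcal{I}}+\sqrt{\epsilon}$ with $\mathcal{I}$ = child.$\mathcal{I}$, and $1$ otherwise. If $id=1$, $\mathcal{I}$ and residual are inherited from the parent. Main loop: initialize the priority queue frontier with only the root (level $0$, value $1$, no parent, $\mathcal{I}=\emptyset$, residual $0$); initialize the set explored and the priority queue repo as empty. Repeat: (1) if frontier and repo are both empty, return failure; (2) if only frontier is empty, move the highest-priority node of repo to frontier and empty explored; (3) remove the highest-priority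 node from frontier; (4) if its level is $p$, stop and return $\mathbf{x}\in\arg\min_{\mathbf{x}\in\mathbb{R}^n}\|\mathbf{Y}_{\mathcal{I}}-\mathcal{O}_{\mathcal{I}}\mathbf{x}\|$ and $\mathcal{I}$ = node.$\mathcal{I}$, encoding the assignment $\mathbf{b}$ with $\mathrm{supp}(\mathbf{b})=\{1,\ldots,p\}\setminus\mathcal{I}$; (5) otherwise add the node to explored and, for $id=0$ then $id=1$, generate the child: if its residual is $1$, or if child.level $-\,|$child.$\mathcal{I}|>\bar{s}$, discard it; else if an equivalent node is in frontier or explored, put the child in repo; else put it in frontier. Each pass through the loop is one iteration. *)

(* Defs.v *)
From mathcomp Require Import all_boot all_order all_algebra.
From mathcomp Require Import boolp classical_sets reals.

Set Implicit Arguments.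
Unset Strict Implicit.
Unset Printing Implicit Defensive.

Import Order.TTheory GRing.Theory Num.Theory.
Local Open Scope ring_scope.

(* The p sensors are indexed by 'I_p, discrete time by nat.  A quantity stacked
   over a window of T instants is a block column with one block of p rows per
   instant. *)
Notation stacked R T p q := 'M[R]_((\sum_(k < T) p)%N, q).

Section Vectors.
Variable R : realType.

(* The norm that the library puts on matrices is the max norm. *)
Definition norm2 m (u : 'cV[R]_m) : R := Num.sqrt (\sum_i u i 0 ^+ 2).

Definition lsq_min m n (y : 'cV[R]_m) (M : 'M[R]_(m, n)) : R :=
  inf (range (fun x : 'cV[R]_n => norm2 (y - M *m x))).

Definition is_lsq_argmin m n (y : 'cV[R]_m) (M : 'M[R]_(m, n))
    (x : 'cV[R]_n) : Prop :=
  forall x' : 'cV[R]_n, norm2 (y - M *m x) <= norm2 (y - M *m x').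

(* Maximum over the real spectrum; it is only applied below to products of a
   positive semidefinite and a positive definite matrix, for which all the
   complex eigenvalues are real. *)
Definition lambda_max n (M : 'M[R]_n) : R :=
  sup [set a : R | eigenvalue M a].

Definition restrict T p q (I : {set 'I_p}) (M : stacked R T p q) :
    stacked R T #|I| q :=
  \mxcol_(k < T) rowsub (@enum_val _ (mem I)) (submxcol M k).

End Vectors.

Section System.
Variables (R : realType) (n p : nat).
Implicit Types (A : 'M[R]_n) (C : 'M[R]_(p, n)) (x v : nat -> 'cV[R]_n).
Implicit Types (y e w : nat -> 'cV[R]_p).

Definition state_eq A x v : Prop :=
  forall tau, x tau.+1 = A *m x tau + v tau.

Definition output_eq C x y e w : Prop :=
  forall tau, y tau = C *m x tau + e tau + w tau.

Definition attacks_only (att : {set 'I_p}) e : Prop :=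
  forall tau i, i \notin att -> e tau i 0 = 0.

Definition reachable A (x' : 'cV[R]_n) : Prop :=
  exists x v, state_eq A x v /\ exists tau, x tau = x'.

Variables (T t : nat).

Definition window_start : nat := (t.+1 - T)%N.

Definition window (z : nat -> 'cV[R]_p) : stacked R T p 1 :=
  \mxcol_(k < T) z (window_start + k)%N.

(* Blocks are numbered from 0 here, so that block k collects the effect of the
   process noise at the k preceding instants of the window. *)
Definition window_noise A C v w : stacked R T p 1 :=
  \mxcol_(k < T)
    (C *m (\sum_(i < k) A ^+ (k.-1 - i) *m v (window_start + i)%N)
     + w (window_start + k)%N).

Definition obs_mx A C : stacked R T p n := \mxcol_(k < T) (C *m A ^+ k).

End System.

Arguments window {R p} T t z.
Arguments window_noise {R n p} T t A C v w.
Arguments obs_mx {R n p} T A C.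

Section Constants.
Variables (R : realType) (n p T : nat).
Variable O : stacked R T p n.

(* Resilience to the removal of any r sensors. *)
Definition sparse_observable (r : nat) : Prop :=
  forall I : {set 'I_p}, (p - r <= #|I|)%N -> \rank (restrict I O) = n.

Definition gram (I : {set 'I_p}) : 'M[R]_n :=
  \sum_(i in I) (restrict [set i] O)^T *m restrict [set i] O.

(* The supremum is over a finite nonempty set. *)
Definition Delta (s : nat) : R :=
  sup [set l : R | exists G I : {set 'I_p},
    [/\ G \subset I, (#|G| <= s)%N, (p - s <= #|I|)%N &
        l = lambda_max (gram G *m invmx (gram I))]].

(* Since Num.sqrt is 0 on negative numbers, 0 <= eps has to be explicit. *)
Definition eps_star (A : 'M[R]_n) : R :=
  inf [set eps : R | 0 <= eps /\
    forall x' xt : 'cV[R]_n, reachable A x' ->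
      is_lsq_argmin (O *m x') O xt ->
      norm2 (O *m x' - O *m xt) <= Num.sqrt eps].

Definition wbar_on (wb : 'I_p -> R) (I : {set 'I_p}) : R :=
  Num.sqrt (\sum_(i in I) wb i ^+ 2).

Definition supp (b : {ffun 'I_p -> bool}) : {set 'I_p} := [set i | b i].

Definition assignment (I : {set 'I_p}) : {ffun 'I_p -> bool} :=
  [ffun i => i \notin I].

Definition feasible (Y : stacked R T p 1) (wb : 'I_p -> R) (eps : R) (s : nat)
    (x : 'cV[R]_n) (b : {ffun 'I_p -> bool}) : Prop :=
  let I := ~: supp b in
  norm2 (restrict I Y - restrict I O *m x) <= wbar_on wb I + Num.sqrt eps
  /\ (#|supp b| <= s)%N.

End Constants.

Section GraphSearch.
Variables (R : realType) (n p T : nat).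
Variables (Y : stacked R T p 1) (O : stacked R T p n).
Variables (wb : 'I_p -> R) (eps : R) (s : nat).

Inductive node := Node {
  level : nat;
  value : bool;
  parent : option node;
  attack_free : {set 'I_p};
  residual : bool }.

Definition equivalent (u v : node) : bool :=
  (level u == level v) && (value u == value v).

Definition declared_attacked (v : node) : nat := (level v - #|attack_free v|)%N.

Definition higher_priority (v v' : node) : bool :=
  (declared_attacked v < declared_attacked v')%N
  || (declared_attacked v == declared_attacked v') && (level v' < level v)%N.

Definition root_node : node := Node 0 true None finset.set0 false.

(* Levels 1..p name the sensors, so level l is the sensor i : 'I_p with
   i.+1 = l. *)
Definition child (u : node) (id : bool) : node :=
  let l := (level u).+1 in
  if id then Node l true (Some u) (attack_free u) (residual u)
  else
    let I := attack_free u :|: [set i : 'I_p | i.+1 == l] in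
    Node l false (Some u) I
      (~~ (lsq_min (restrict I Y) (restrict I O)
           <= wbar_on wb I + Num.sqrt eps)).

Record queues := Queues {
  frontier : seq node;
  explored : seq node;
  repo : seq node }.

(* Removal of a node of highest priority, ties being resolved arbitrarily. *)
Definition pops (q : seq node) (v : node) (q' : seq node) : Prop :=
  exists q1 q2, [/\ q = q1 ++ v :: q2, q' = q1 ++ q2 &
                    ~~ has (fun v' => higher_priority v' v) q].

Inductive refill : queues -> queues -> Prop :=
| refill_skip F E P : F <> [::] -> refill (Queues F E P) (Queues F E P)
| refill_repo E P v P' : pops P v P' ->
    refill (Queues [::] E P) (Queues [:: v] [::] P').

Definition insert_child (u : node) (st : queues) (id : bool) : queues :=
  let c := child u id in
  if residual c || (s < declared_attacked c)%N then st
  else if has (equivalent c) (frontier st ++ explored st)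
  then Queues (frontier st) (explored st) (c :: repo st)
  else Queues (c :: frontier st) (explored st) (repo st).

Inductive config :=
| Running of queues
| Failure
| Returned of 'cV[R]_n & {set 'I_p}.

(* One pass through the main loop. *)
Inductive iteration : config -> config -> Prop :=
| iter_failure E :
    iteration (Running (Queues [::] E [::])) Failure
| iter_return st F E P v F' x :
    refill st (Queues F E P) -> pops F v F' -> level v = p ->
    is_lsq_argmin (restrict (attack_free v) Y) (restrict (attack_free v) O) x ->
    iteration (Running st) (Returned x (attack_free v))
| iter_expand st F E P v F' :
    refill st (Queues F E P) -> pops F v F' -> level v <> p ->
    iteration (Running st)
      (Running (foldl (insert_child v) (Queues F' (v :: E) P) [:: false; true])).

Definition initial : config := Running (Queues [:: root_node] [::] [::]).

(* cfg k is the configuration after k iterations; a configuration without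
   successor is repeated forever, so a run may be stopped, but not stopped
   early. *)
Definition run (cfg : nat -> config) : Prop :=
  cfg 0%N = initial /\
  forall k, iteration (cfg k) (cfg k.+1)
            \/ (forall c, ~ iteration (cfg k) c) /\ cfg k.+1 = cfg k.

Definition complete : Prop :=
  (exists (x : 'cV[R]_n) (b : {ffun 'I_p -> bool}), feasible O Y wb eps s x b) ->
  forall cfg, run cfg ->
    exists N x I, cfg N = Returned x I /\
                  feasible O Y wb eps s x (assignment I).

End GraphSearch.

(* Main.v *)
Require Import Defs.
From mathcomp Require Import all_boot all_order all_algebra.
From mathcomp Require Import boolp classical_sets reals.
From mathcomp Require Import zify.

Set Implicit Arguments.
Unset Strict Implicit.
Unset Printing Implicit Defensive.

Import Order.TTheory GRing.Theory Num.Theory.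
Local Open Scope ring_scope.

(** The search never loses a node: a child that survives the residual test and
    the bound on the number of declared attacks always lands in the frontier or
    in the repo, and a refill only moves nodes between the two queues.  The
    priorities therefore affect the order of exploration only, and the run is an
    exhaustive traversal of a pruned binary tree of depth [p].  Two facts make
    this traversal succeed.

    - The branch of the true assignment is never pruned.  If [I] contains
      unattacked sensors only, the true initial state [x0] has residual
      [Y_I - O_I x0 = w_I], whose norm is at most [wbar_I], so every set [I] met
      on that branch passes the test ([lsq_min_unattacked]); and the branch
      declares at most [#|att|] sensors attacked ([on_path_kept]).  Hence a node
      of this branch is always pending ([on_path_expand]), so the search cannot
      fail.  The true assignment, rather than an arbitrary feasible one, is
      needed here: the test bound [wbar_I] shrinks with [I], so the feasibility
      of a leaf says nothing about its ancestors.

    - Every pending node passed the test with its current set [attack_free], so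
      a pending leaf, together with a least-squares solution, is feasible
      ([viable_leaf_feasible]).

    Expanding a node replaces it by at most two nodes one level deeper, so the
    sum of [3 ^ (p - level)] over the pending nodes decreases strictly and a leaf
    is eventually popped.  The step that returns at a leaf is always possible
    because a least-squares problem has a minimizer ([lsq_argmin_exists]). *)

(** * Euclidean least squares *)

Section LeastSquares.
Variable R : realType.

Lemma norm2_ge0 m (u : 'cV[R]_m) : 0 <= norm2 u.
Proof. exact: sqrtr_ge0. Qed.

Lemma sum_sqr_ge0 m (u : 'cV[R]_m) : 0 <= \sum_i u i 0 ^+ 2.
Proof. by apply: sumr_ge0 => i _; apply: sqr_ge0. Qed.

Lemma sqr_norm2 m (u : 'cV[R]_m) : norm2 u ^+ 2 = \sum_i u i 0 ^+ 2.
Proof. by rewrite sqr_sqrtr // sum_sqr_ge0. Qed.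

Lemma sqr_norm2E m (u : 'cV[R]_m) : norm2 u ^+ 2 = (u^T *m u) 0 0.
Proof.
by rewrite sqr_norm2 mxE; apply: eq_bigr => i _; rewrite mxE expr2.
Qed.

Lemma norm2_eq0 m (u : 'cV[R]_m) : norm2 u = 0 -> u = 0.
Proof.
move=> u0; have /eqP : \sum_i u i 0 ^+ 2 = 0 by rewrite -sqr_norm2 u0 expr0n.
rewrite psumr_eq0 => [/allP uP|i _]; last exact: sqr_ge0.
apply/colP => i; rewrite mxE; apply/eqP; rewrite -sqrf_eq0.
by apply: uP; rewrite mem_index_enum.
Qed.

Lemma norm2_le_sqr m k (u : 'cV[R]_m) (w : 'cV[R]_k) :
  norm2 u ^+ 2 <= norm2 w ^+ 2 -> norm2 u <= norm2 w.
Proof. by rewrite ler_pXn2r // nnegrE norm2_ge0. Qed.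

Lemma pythagoras m (u w : 'cV[R]_m) :
  w^T *m u = 0 -> norm2 u <= norm2 (u + w).
Proof.
move=> wu0; apply: norm2_le_sqr; rewrite !sqr_norm2E.
have uw0 : u^T *m w = 0 by rewrite -[u^T *m w]trmxK trmx_mul trmxK wu0 trmx0.
rewrite [(u + w)^T]linearD /= mulmxDl !mulmxDr uw0 wu0 addr0 add0r.
rewrite [leRHS]mxE lerDl -sqr_norm2E.
exact: sqr_ge0.
Qed.

(** [M^T *m M] and [M^T] have the same left kernel: if [z *m M^T *m M = 0] then
    [z *m M^T] is orthogonal to itself. *)
Lemma mxrank_gram m n (M : 'M[R]_(m, n)) : \rank (M^T *m M) = \rank M.
Proof.
apply/eqP; rewrite eqn_leq mxrankM_maxr /=.
suff : (\rank (kermx (M^T *m M)) <= \rank (kermx M^T))%N.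
  rewrite !mxrank_ker mxrank_tr.
  move: (rank_leq_row (M^T *m M)) (rank_leq_col M); lia.
apply/mxrankS/row_subP => i; apply/sub_kermxP.
set z := row i _.
have zMM : z *m (M^T *m M) = 0 by rewrite /z -row_mul mulmx_ker row0.
apply: trmx_inj; rewrite trmx0; apply: norm2_eq0; apply/eqP.
rewrite -sqrf_eq0 sqr_norm2E trmxK trmx_mul trmxK !mulmxA.
by rewrite -(mulmxA z) zMM mul0mx mxE.
Qed.

(** By the rank equality above, [M^T *m M] has the whole row space of [M], so
    the normal equations are solvable even when [M] is rank-deficient. *)
Lemma normal_equations m n (y : 'cV[R]_m) (M : 'M[R]_(m, n)) :
  exists x, M^T *m (y - M *m x) = 0.
Proof.
have MleMM : (M <= M^T *m M)%MS.
  by rewrite -(geq_leqif (mxrank_leqif_sup (submxMl M^T M))) mxrank_gram.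
have /submxP[z yE] : (y^T *m M <= M^T *m M)%MS.
  exact: submx_trans (submxMl _ _) MleMM.
exists z^T; apply: trmx_inj.
rewrite trmx0 trmx_mul trmxK linearB /= trmx_mul trmxK mulmxBl yE.
by rewrite mulmxA subrr.
Qed.

(** A solution of the normal equations has a residual orthogonal to the range of
    [M], hence the shortest one. *)
Lemma lsq_argmin_exists m n (y : 'cV[R]_m) (M : 'M[R]_(m, n)) :
  exists x, is_lsq_argmin y M x.
Proof.
have [x Mx0] := normal_equations y M; exists x => x'.
have -> : y - M *m x' = (y - M *m x) + M *m (x - x').
  by rewrite mulmxBr addrA subrK.
by apply: pythagoras; rewrite trmx_mul -mulmxA Mx0 mulmx0.
Qed.

Lemma lsq_min_le m n (y : 'cV[R]_m) (M : 'M[R]_(m, n)) x :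
  lsq_min y M <= norm2 (y - M *m x).
Proof.
apply: ge_inf; last by exists x.
by exists 0 => _ [z _ <-]; apply: norm2_ge0.
Qed.

Lemma lsq_argmin_le m n (y : 'cV[R]_m) (M : 'M[R]_(m, n)) x :
  is_lsq_argmin y M x -> norm2 (y - M *m x) <= lsq_min y M.
Proof.
move=> xmin; apply: lb_le_inf; first by exists (norm2 (y - M *m 0)); exists 0.
by move=> _ [z _ <-]; apply: xmin.
Qed.

End LeastSquares.

(** * Restriction to a set of sensors *)

Section Restriction.
Variables (R : realType) (T p : nat).
Implicit Types I : {set 'I_p}.

Lemma restrictD q I (M N : stacked R T p q) :
  restrict I (M + N) = restrict I M + restrict I N.
Proof.
rewrite /restrict -mxcolD; apply: eq_mxcol => k.
by rewrite submxcolD; apply/matrixP => i j; rewrite !mxE.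
Qed.

Lemma restrictM q r I (M : stacked R T p q) (x : 'M[R]_(q, r)) :
  restrict I (M *m x) = restrict I M *m x.
Proof.
rewrite /restrict mxcol_mul; apply: eq_mxcol => k.
apply/matrixP => i j; rewrite !mxE; apply: eq_bigr => l _.
by rewrite !mxE.
Qed.

(** The squared norm of a stacked signal is additive over sensors, which is what
    turns the bounds for single sensors into the bound [wbar_on]. *)
Lemma sqr_norm2_restrict I (W : stacked R T p 1) :
  norm2 (restrict I W) ^+ 2 =
  \sum_(i in I) \sum_(k < T) submxcol W k i 0 ^+ 2.
Proof.
rewrite sqr_norm2E /restrict tr_mxcol mul_mxrow_mxcol summxE exchange_big /=.
apply: eq_bigr => k _; rewrite -sqr_norm2E sqr_norm2 [RHS]big_enum_val /=.
by apply: eq_bigr => j _; rewrite mxE.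
Qed.

Lemma norm2_restrict_le I (W : stacked R T p 1) (wb : 'I_p -> R) :
  (forall i, norm2 (restrict [set i] W) <= wb i) ->
  norm2 (restrict I W) <= wbar_on wb I.
Proof.
move=> Wwb; rewrite -[leLHS]ger0_norm ?norm2_ge0 // -sqrtr_sqr.
rewrite ler_wsqrtr // sqr_norm2_restrict.
apply: ler_sum => i _; have wb0 := le_trans (norm2_ge0 _) (Wwb i).
have : norm2 (restrict [set i] W) ^+ 2 <= wb i ^+ 2.
  by rewrite ler_pXn2r // nnegrE norm2_ge0.
by rewrite sqr_norm2_restrict big_set1.
Qed.

End Restriction.

(** * The true state and the unattacked sensors *)

Section Measurements.
Variables (R : realType) (n p : nat) (A : 'M[R]_n) (C : 'M[R]_(p, n)).
Variables (x v : nat -> 'cV[R]_n) (y e w : nat -> 'cV[R]_p) (T t : nat).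
Hypotheses (hx : state_eq A x v) (hy : output_eq C x y e w).

(** Variation of constants. *)
Lemma state_after a k :
  x (a + k)%N = A ^+ k *m x a
                + \sum_(i < k) A ^+ (k.-1 - i) *m v (a + i)%N.
Proof.
elim: k => [|k IHk].
  by rewrite addn0 big_ord0 addr0 expr0 -[LHS]mul1mx.
rewrite addnS hx IHk mulmxDr mulmxA -[A *m A ^+ k]/(A * A ^+ k) -exprS.
rewrite big_ord_recr /= subnn expr0 mul1mx -addrA; congr (_ + (_ + _)).
rewrite mulmx_sumr; apply: eq_bigr => i _.
rewrite mulmxA -[A *m A ^+ _]/(A * A ^+ _) -exprS; congr (A ^+ _ *m _).
by have := ltn_ord i; lia.
Qed.

Lemma window_output :
  window T t y = obs_mx T A C *m x (window_start T t) + window T t e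
                 + window_noise T t A C v w.
Proof.
rewrite /obs_mx mxcol_mul -!mxcolD; apply: eq_mxcol => k.
rewrite hy state_after mulmxDr mulmxA -!addrA; congr (_ + _).
by rewrite addrCA.
Qed.

Lemma restrict_window_attack (att I : {set 'I_p}) :
  attacks_only att e -> [disjoint I & att] -> restrict I (window T t e) = 0.
Proof.
move=> he dI; rewrite -[RHS]mxcol0.
apply: eq_mxcol => k; rewrite mxcolK; apply/matrixP => i j.
by rewrite !mxE ord1 he // (disjointFr dI) // enum_valP.
Qed.

(** The state at the start of the window leaves only the noise as residual, and
    the minimum over all states is no larger. *)
Lemma lsq_min_unattacked (att I : {set 'I_p}) (wb : 'I_p -> R) :
  attacks_only att e ->
  (forall i, norm2 (restrict [set i] (window_noise T t A C v w)) <= wb i) ->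
  [disjoint I & att] ->
  lsq_min (restrict I (window T t y)) (restrict I (obs_mx T A C))
    <= wbar_on wb I.
Proof.
move=> he hw dI; apply: le_trans (norm2_restrict_le I hw).
apply: le_trans (lsq_min_le _ _ (x (window_start T t))) _.
rewrite window_output !restrictD restrictM.
by rewrite (restrict_window_attack he dI) addr0 addrC addKr.
Qed.

End Measurements.

(** * The priority queues *)

Section Queues.
Variable p : nat.
Implicit Types (u v : node p) (q : seq (node p)) (st : queues p).

(** [higher_priority] is a strict weak order, so a nonempty queue has a node that
    no other one precedes. *)
Lemma pops_exists q : q <> [::] -> exists v q', pops q v q'.
Proof.
suff best : q <> [::] -> exists q1 v q2,
    q = q1 ++ v :: q2 /\ ~~ has (fun u => higher_priority u v) q.
  by move=> /best[q1 [v [q2 [qE vmax]]]]; exists v, (q1 ++ q2), q1, q2.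
elim: q => // a [|b q] IHq _.
  by exists [::], a, [::]; split=> //=; rewrite /higher_priority; lia.
have [//|q1 [v [q2 [qE vmax]]]] := IHq.
have [av|av] := boolP (higher_priority a v); last first.
  exists (a :: q1), v, q2; split; first by rewrite qE.
  by rewrite -cat1s has_cat /= orbF negb_or av.
exists [::], a, (b :: q); split=> //.
apply: contra vmax; rewrite -cat1s has_cat => /orP[|].
  by rewrite /= /higher_priority; lia.
apply: sub_has => u; move: av; rewrite /higher_priority; lia.
Qed.

(** Explored nodes only influence into which queue a child goes; the pending ones
    are the search state that matters. *)
Definition pending st := frontier st ++ repo st.

(** Queues change by permutations, insertions and removals of nodes, which do not
    form an [eqType].  Folding an arbitrary commutative monoid law over the
    pending nodes tracks them as a multiset; the laws used are conjunction,
    disjunction and addition, for [all], [has] and the weight. *)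
Section BigPending.
Variables (S : Type) (idx : S) (op : Monoid.com_law idx) (f : node p -> S).

Lemma big_pops q v q' : pops q v q' ->
  \big[op/idx]_(c <- q) f c = op (f v) (\big[op/idx]_(c <- q') f c).
Proof.
by move=> [q1 [q2 [-> -> _]]]; rewrite !big_cat big_cons /= Monoid.mulmCA.
Qed.

Lemma big_refill st st' : refill st st' ->
  \big[op/idx]_(c <- pending st) f c = \big[op/idx]_(c <- pending st') f c.
Proof.
case=> // E P v P' /big_pops vP.
by rewrite /pending /= vP big_cons.
Qed.

Lemma big_next st F E P v F' : refill st (Queues F E P) -> pops F v F' ->
  \big[op/idx]_(c <- pending st) f c
  = op (f v) (\big[op/idx]_(c <- F' ++ P) f c).
Proof.
by move=> /big_refill-> /big_pops vF; rewrite !big_cat /= vF Monoid.mulmA.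
Qed.

End BigPending.

End Queues.

(** * The search tree *)

Section Search.
Variables (R : realType) (n p T : nat).
Variables (Y : stacked R T p 1) (O : stacked R T p n).
Variables (wb : 'I_p -> R) (eps : R) (s : nat).
Implicit Types (u v : node p) (st : queues p).

Let child := child Y O wb eps.
Let insert_child := insert_child Y O wb eps s.

Definition kept u := ~~ (residual u || (s < declared_attacked u)%N).

Definition expand u := [seq c <- [:: child u false; child u true] | kept c].

(** Whether an equivalent node is present decides between frontier and repo, but
    not whether a child stays pending. *)
Lemma big_expand (S : Type) (idx : S) (op : Monoid.com_law idx)
    (f : node p -> S) u st :
  \big[op/idx]_(c <- pending (foldl (insert_child u) st [:: false; true])) f c
  = op (\big[op/idx]_(c <- expand u) f c) (\big[op/idx]_(c <- pending st) f c).
Proof.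
have ins st' id : \big[op/idx]_(c <- pending (insert_child u st' id)) f c =
    op (if kept (child u id) then f (child u id) else idx)
       (\big[op/idx]_(c <- pending st') f c).
  rewrite /insert_child /Defs.insert_child -/child /kept.
  case: ifP => _ /=; first by rewrite Monoid.mul1m.
  case: ifP => _; rewrite /pending /= ?big_cons //.
  by rewrite !big_cat big_cons /= Monoid.mulmCA.
rewrite /= !ins /expand big_filter !big_cons big_nil.
do 2!case: ifP => _; rewrite ?Monoid.mulm1 ?Monoid.mul1m //.
by rewrite Monoid.mulmCA Monoid.mulmA.
Qed.

Lemma has_expand (P : pred (node p)) u id :
  kept (child u id) -> P (child u id) -> has P (expand u).
Proof.
rewrite /expand; case: id; move: (child u false) (child u true) => c0 c1 /= ->.
  by case: ifP => _ /= ->; rewrite ?orbT.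
by move=> /= ->.
Qed.

Definition consistent (I : {set 'I_p}) : bool :=
  lsq_min (restrict I Y) (restrict I O) <= wbar_on wb I + Num.sqrt eps.

(** The test is repeated here because a node of value 1 only inherits its
    [residual] flag, and the root is never tested. *)
Definition viable u : bool :=
  [&& (level u <= p)%N, consistent (attack_free u) & kept u].

Lemma viable_expand u : viable u -> level u <> p -> all viable (expand u).
Proof.
case/and3P=> lu cu ku lup.
have lu' : (level u < p)%N by rewrite ltn_neqAle lu andbT; apply/eqP.
suff H id : kept (child u id) ==> viable (child u id).
  by rewrite all_filter; apply/and3P; split; first exact: H; first exact: H.
apply/implyP => kc; apply/and3P; split=> //; case: id kc => //.
by rewrite /kept negb_or negbK => /andP[].
Qed.

(** The nodes on the branch of the assignment that declares exactly the sensors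
    of [att] attacked. *)
Definition on_path (att : {set 'I_p}) u : bool :=
  ~~ residual u
  && (attack_free u == [set i : 'I_p | (i < level u)%N & i \notin att]).

Lemma card_first_sensors l : (l <= p)%N -> #|[set i : 'I_p | (i < l)%N]| = l.
Proof.
move=> lp; have inj : injective (widen_ord lp).
  by move=> i j /(congr1 val) ij; apply: val_inj.
rewrite -[RHS]card_ord -(card_imset _ inj).
apply: eq_card => i; rewrite inE; apply/idP/imsetP => [il|[j _ ->]] /=.
  by exists (Ordinal il) => //; apply: val_inj.
exact: ltn_ord.
Qed.

(** The sensors up to the level of the node are either declared attack-free or in
    [att]. *)
Lemma on_path_kept (att : {set 'I_p}) u :
  (#|att| <= s)%N -> (level u <= p)%N -> on_path att u -> kept u.
Proof.
move=> atts lu /andP[ru /eqP uE]; rewrite /kept negb_or ru -leqNgt.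
apply: leq_trans atts; rewrite /declared_attacked leq_subLR uE.
rewrite -{1}(card_first_sensors lu); apply: leq_trans (leq_card_setU _ _).
apply/subset_leq_card/fintype.subsetP => i; rewrite !inE => ->.
by case: (i \in att).
Qed.

(** The child to follow declares the next sensor attacked iff it is in [att]. *)
Lemma on_path_expand (att : {set 'I_p}) u :
  (forall I : {set 'I_p}, [disjoint I & att] -> consistent I) ->
  (#|att| <= s)%N ->
  (level u < p)%N -> on_path att u -> has (on_path att) (expand u).
Proof.
move=> hatt atts lu /andP[ru /eqP uE].
suff : on_path att (child u (Ordinal lu \in att)).
  move=> cpath; apply: (has_expand _ cpath).
  by apply: on_path_kept atts _ cpath; case: (_ \in att).
(* Stated for a variable [b] so that both children are covered at once. *)
have setE (b : bool) : b = (Ordinal lu \in att) ->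
    attack_free (child u b)
    = [set i : 'I_p | (i < (level u).+1)%N & i \notin att].
  move=> bE; apply/setP => i; rewrite !inE ltnS leq_eqVlt.
  have iE : (i == level u :> nat) = (i == Ordinal lu) by [].
  case: b bE => bE; rewrite /= uE ?inE ?eqSS iE;
    by case: eqP => [->|_]; rewrite -?bE ?ltnn ?orbT ?orbF.
apply/andP; split; last by rewrite (setE _ erefl); case: (_ \in att).
case: (boolP (_ \in att)) => //= iatt; rewrite negbK.
apply: hatt; have /= -> := setE false (esym (negbTE iatt)).
rewrite finset.disjoints_subset; apply/fintype.subsetP => i.
by rewrite !inE => /andP[].
Qed.

(** The base 3 exceeds the number of children, so that expansion decreases the
    weight. *)
Definition weight st : nat := \sum_(u <- pending st) 3 ^ (p - level u).

Lemma weight_expand u : (level u < p)%N ->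
  (\sum_(c <- expand u) 3 ^ (p - level c) < 3 ^ (p - level u))%N.
Proof.
move=> lu; rewrite big_filter !big_cons big_nil /= !addn0.
have -> : (p - level u = (p - (level u).+1).+1)%N by lia.
rewrite expnS; have : (0 < 3 ^ (p - (level u).+1))%N by rewrite expn_gt0.
by do 2![case: ifP => _]; lia.
Qed.

Lemma viable_leaf_feasible u x : viable u -> level u = p ->
  is_lsq_argmin (restrict (attack_free u) Y) (restrict (attack_free u) O) x ->
  feasible O Y wb eps s x (assignment (attack_free u)).
Proof.
move=> /and3P[_ cu]; rewrite /kept negb_or -leqNgt => /andP[_ du] lu xmin.
have suppE : supp (assignment (attack_free u)) = ~: attack_free u.
  by apply/setP => i; rewrite !inE ffunE.
rewrite /feasible suppE finset.setCK; split.
  exact: le_trans (lsq_argmin_le xmin) cu.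
rewrite cardsCs finset.setCK card_ord.
by move: du; rewrite /declared_attacked lu.
Qed.

(** A running search with a pending node is never stuck, so a run that repeats
    its configuration has already stopped. *)
Lemma iteration_exists st : pending st <> [::] ->
  exists c, iteration Y O wb eps s (Running R n st) c.
Proof.
move=> st0.
have [F [E [P [v [F' [ref popF]]]]]] : exists F E P v F',
    refill st (Queues F E P) /\ pops F v F'.
  case: st st0 => -[|a F] E P st0.
    have [v [P' popP]] := pops_exists st0.
    exists [:: v], [::], P', v, [::]; split; first by constructor.
    by exists [::], [::]; split=> //=; rewrite /higher_priority; lia.
  have [//|v [F' popF]] := @pops_exists _ (a :: F).
  by exists (a :: F), E, P, v, F'; split=> //; constructor.
have [lv|lv] := pselect (level v = p).
  have [z zmin] := lsq_argmin_exists (restrict (attack_free v) Y)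
                                     (restrict (attack_free v) O).
  by exists (Returned z (attack_free v)); apply: iter_return ref popF lv zmin.
by eexists; apply: iter_expand ref popF lv.
Qed.

Lemma iteration_inv st c :
  iteration Y O wb eps s (Running R n st) c -> pending st <> [::] ->
  exists F E P v F', [/\ refill st (Queues F E P), pops F v F' &
    (level v = p /\ exists2 x,
       is_lsq_argmin (restrict (attack_free v) Y) (restrict (attack_free v) O) x
       & c = Returned x (attack_free v))
    \/ (level v <> p /\
        c = Running R n (foldl (insert_child v) (Queues F' (v :: E) P)
                               [:: false; true]))].
Proof.
move=> it; inversion it as [E|st' F E P v F' x ref pop lv xmin|
                            st' F E P v F' ref pop lv] => // _.
  by exists F, E, P, v, F'; split=> //; left; split=> //; exists x.
by exists F, E, P, v, F'; split=> //; right.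
Qed.

(** Completeness of the search for arbitrary data [Y] and [O], as soon as some
    assignment [att] within the attack budget passes the test on every set of
    sensors that it declares attack-free, in particular all along its branch. *)
Theorem complete_of_consistent (att : {set 'I_p}) :
  (#|att| <= s)%N ->
  (forall I : {set 'I_p}, [disjoint I & att] -> consistent I) ->
  complete Y O wb eps s.
Proof.
move=> atts hatt _ cfg [cfg0 step].
suff H k st : cfg k = Running R n st -> all viable (pending st) ->
    has (on_path att) (pending st) ->
    exists N x I, cfg N = Returned x I /\
                  feasible O Y wb eps s x (assignment I).
  apply: (H 0%N _ cfg0); rewrite /= ?andbT ?orbF.
    rewrite /viable /kept /= hatt //.
    by rewrite finset.disjoints_subset finset.sub0set.
  by apply/eqP/setP => i; rewrite !inE.
have [N] := ubnP (weight st).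
elim: N k st => // N IHN k st; rewrite ltnS => wN kst viast pathst.
have st0 : pending st <> [::] by move=> st0; rewrite st0 in pathst.
have [it|[stuck _]] := step k; last first.
  by have [c] := iteration_exists st0; rewrite -kst => /stuck.
rewrite kst in it.
have [F [E [P [v [F' [ref pop]]]]]] := iteration_inv it st0.
set X := F' ++ P.
have /andP[vv viaX] : viable v && all viable X.
  by rewrite -big_all -(big_next _ _ ref pop) big_all.
have pathX : on_path att v || has (on_path att) X.
  by rewrite -big_has -(big_next _ _ ref pop) big_has.
have weightX :
    weight st = (3 ^ (p - level v) + \sum_(c <- X) 3 ^ (p - level c))%N.
  exact: big_next ref pop.
case=> [[lv [x xmin kst']]|[lv kst']].
  by exists k.+1, x, (attack_free v); split=> //; apply: viable_leaf_feasible.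
have lv' : (level v < p)%N.
  by case/and3P: vv => lv' _ _; rewrite ltn_neqAle lv' andbT; apply/eqP.
apply: (IHN _ _ _ kst').
- rewrite /weight big_expand /=; have := weight_expand lv'.
  by move: wN; rewrite weightX /X /pending /=; lia.
- by rewrite -big_all big_expand !big_all viable_expand.
- rewrite -big_has big_expand !big_has; apply/orP.
  by case/orP: pathX => [vpath|pathX]; [left; apply: on_path_expand | right].
Qed.

End Search.

Theorem theorem4 (R : realType) (n p : nat)
    (A : 'M[R]_n) (C : 'M[R]_(p, n))
    (x v : nat -> 'cV[R]_n) (y e w : nat -> 'cV[R]_p)
    (T t s : nat) (att : {set 'I_p}) (wb : 'I_p -> R) (eps : R)
    (hT : (1 <= T <= n)%N) (ht : (T <= t.+1)%N)
    (hs : (s.+1 <= uphalf p)%N)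
    (hx : state_eq A x v) (hy : output_eq C x y e w)
    (he : attacks_only att e)
    (hw : forall i : 'I_p,
        norm2 (restrict [set i] (window_noise T t A C v w)) <= wb i)
    (hobs : sparse_observable (obs_mx T A C) (2 * s))
    (heps0 : 0 <= eps)
    (heps : eps = eps_star (obs_mx T A C) A)
    (hS : (#|att| < s)%N)
    (hatt : forall i : 'I_p, i \in att ->
        2 / Num.sqrt (1 - Delta (obs_mx T A C) s) * wbar_on wb finset.setT
        + Num.sqrt eps / Num.sqrt (1 - Delta (obs_mx T A C) s)
        < norm2 (restrict [set i] (window T t e))) :
  complete (window T t y) (obs_mx T A C) wb eps s.
Proof.
apply: (@complete_of_consistent _ _ _ _ _ _ _ _ _ att); first exact: ltnW.
move=> I dI; apply: le_trans (lsq_min_unattacked hx hy he hw dI) _.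
by rewrite lerDl sqrtr_ge0.
Qed.
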